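(* Let $m\ge0$, let $(\vec X^m,\kappa^m_\sigma)\in\underline V(\Gamma^m)\times V(\Gamma^m)$ be given, and let $(\boldsymbol W^{m+1},\vec X^{m+1},\kappa^{m+1}_\sigma)\in\boldsymbol S^m_\Sigma\times\underline V(\Gamma^m)\times V(\Gamma^m)$ be a solution of $$\langle\nabla\boldsymbol W^{m+1},\nabla\boldsymbol\varphi\rangle_\Omega-\sum_{(i,j,k)\in\Lambda}\Big\langle\pi^h_i\Big[\tfrac{\vec X^{m+1}_i-\vec X^m_i}{\tau_m}\cdot\vec\omega^m_i\Big],\varphi_j-\varphi_k\Big\rangle^{(h)}_{\Gamma^m_i}=0\quad\forall\,\boldsymbol\varphi\in\boldsymbol S^m_\Sigma,$$ $$\langle\kappa^{m+1}_\sigma,\xi\rangle^h_{\Gamma^m}-\sum_{(i,j,k)\in\Lambda}\langle W^{m+1}_j-W^{m+1}_k,\xi_i\rangle^{(h)}_{\Gamma^m_i}=0\quad\forall\,\xi\in V(\Gamma^m),$$ $$\langle\kappa^{m+1}_\sigma\vec\omega^m,\vec\eta\rangle^h_{\Gamma^m}+\langle\sigma\nabla_s\vec X^{m+1},\nabla_s\vec\eta\rangle_{\Gamma^m}=0\quad\forall\,\vec\eta\in\underline V(\Gamma^m),$$ where the superscript $(h)$ means that either mass lumping ($h$) is used or it is omitted, consistently in both equations where it appears. Then, for each of the two choices, $$|\Gamma^{m+1}|_\sigma+\tau_m\|\nabla\boldsymbol W^{m+1}\|_2^2\le|\Gamma^m|_\sigma,$$ where $|\Gamma^m|_\sigma=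\sum_{i=1}^3\sigma_i|\Gamma^m_i|$.
   Context: $\Omega\subset\mathbb R^2$ is a bounded domain, $\mathfrak T^m$ a triangulation of $\overline\Omega$, $S^m=\{v\in C(\overline\Omega)\mid v|_o\text{ affine }\forall o\in\mathfrak T^m\}$, and $\boldsymbol S^m_\Sigma=\{\boldsymbol\varphi=(\varphi_1,\varphi_2,\varphi_3)\in[S^m]^3\mid\varphi_1+\varphi_2+\varphi_3=0\}$. $\Lambda=\{(1,3,2),(2,1,3),(3,2,1)\}$. $\tau_m>0$ is the time step and $\sigma_1,\sigma_2,\sigma_3>0$ are surface tensions with $\sigma_1\le\sigma_2+\sigma_3$, $\sigma_2\le\sigma_1+\sigma_3$, $\sigma_3\le\sigma_1+\sigma_2$; $\sigma=\sigma_i$ on $\Gamma^m_i$. Curves. For $i=1,2,3$, $I=[0,1]$ is split as $I=\bigcup_{j=1}^{N_i}[q_{i,j-1},q_{i,j}]$ with $0=q_{i,0}<\dots<q_{i,N_i}=1$, $N_i\ge2$. $V^h_i$ is the space of continuous functions on $I$ that are affine on each $[q_{i,j-1},q_{i,j}]$, $\underline V^h_i=[V^h_i]^2$, and $\pi^h_i:C(I)\to V^h_i$ is the nodal interpolation operator. $V(\Gamma^m)=V^h_1\times V^h_2\times V^h_3$ and $\underline V(\Gamma^m)=\{(\vec X_1,\vec X_2,\vec X_3)\in\underline V^h_1\times\underline V^h_2\times\underline V^h_3\mid\vec X_1=\vec X_2=\vec X_3\text{ on }\partial I=\{0,1\}\}$. Given $\vec X^m\in\underline V(\Gamma^m)$,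 the polygonal curves are $\Gamma^m_i=\vec X^m_i(I)\subset\Omega$, with vertices $\vec q^m_{i,j}=\vec X^m_i(q_{i,j})$ and edges $e^m_{i,j}=[\vec q^m_{i,j-1},\vec q^m_{i,j}]$ of positive length $|e^m_{i,j}|$; likewise $\Gamma^{m+1}_i=\vec X^{m+1}_i(I)$. $|\Gamma^m_i|=\sum_{j=1}^{N_i}|e^m_{i,j}|$ is the length of the polygonal curve, and similarly for $\Gamma^{m+1}_i$. The unit normal $\vec\nu^m_i$ equals $(\vec q^m_{i,j}-\vec q^m_{i,j-1})^\perp/|e^m_{i,j}|$ on $e^m_{i,j}$, where $\binom ab^\perp=\binom{-b}{a}$. Inner products. Functions on $\Gamma^m_i$ are identified with functions on $I$ via $\vec X^m_i$; bulk functions $\varphi\in S^m$ are restricted to $\Gamma^m_i$ (i.e. $\varphi\circ\vec X^m_i$). $\langle u,v\rangle_{\Gamma^m_i}=\int_{\Gamma^m_i}u\,v\,\mathrm d\mathcal H^1=\int_I u\,v\,|\partial_\rho\vec X^m_i|\,\mathrm d\rho$, and the mass-lumped product is $\langle u,v\rangle^h_{\Gamma^m_i}=\frac12\sum_{j=1}^{N_i}|e^m_{i,j}|\big((uv)(q_{i,j}^-)+(uv)(q_{i,j-1}^+)\big)$ with one-sided limits from within $[q_{i,j-1},q_{i,j}]$; both extend to vector- and tensor-valued functions with the Euclidean/Frobenius product. $\langle u,v\rangle^{(h)}_{\Gamma^m}=\sum_{i=1}^3\langle u_i,v_i\rangle^{(h)}_{\Gamma^m_i}$. $\langle\nabla\boldsymbol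 W,\nabla\boldsymbol\varphi\rangle_\Omega=\sum_{j=1}^3\int_\Omega\nabla W_j\cdot\nabla\varphi_j\,\mathrm d\mathcal L^2$ and $\|\nabla\boldsymbol W\|_2^2=\langle\nabla\boldsymbol W,\nabla\boldsymbol W\rangle_\Omega$. $\nabla_s$ is the arclength derivative on $\Gamma^m$, i.e. $\langle\sigma\nabla_s\vec X,\nabla_s\vec\eta\rangle_{\Gamma^m}=\sum_{i=1}^3\sigma_i\int_I\partial_\rho\vec X_i\cdot\partial_\rho\vec\eta_i\,|\partial_\rho\vec X^m_i|^{-1}\,\mathrm d\rho$. Vertex normals. $\vec\omega^m_i\in\underline V^h_i$ is defined by $\langle\vec\omega^m_i,\vec\xi\rangle^h_{\Gamma^m_i}=\langle\vec\nu^m_i,\vec\xi\rangle_{\Gamma^m_i}$ for all $\vec\xi\in\underline V^h_i$; $\vec\omega^m=(\vec\omega^m_1,\vec\omega^m_2,\vec\omega^m_3)$. *)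

(* Defs.v *)
From HB Require Import structures.
From mathcomp Require Import all_boot all_order all_algebra.
From mathcomp Require Import all_classical all_reals all_analysis.

Set Implicit Arguments.
Unset Strict Implicit.
Unset Printing Implicit Defensive.

Import Order.TTheory GRing.Theory Num.Theory numFieldNormedType.Exports.
Local Open Scope classical_set_scope.
Local Open Scope ring_scope.

Section Plane.
Context {R : realType}.
Implicit Types (u v : R * R) (s : seq (R * R)).

(* The library norm on R * R is the sup norm, hence the explicit Euclidean
   structure. *)
Definition dot u v : R := u.1 * v.1 + u.2 * v.2.
Definition enorm u : R := Num.sqrt (dot u u).
Definition perp u : R * R := (- u.2, u.1).

(* Convex hull of finitely many points; it is empty for s = [::]. *)
Definition conv s : set (R * R) :=
  [set x | exists l : 'I_(size s) -> R,
    [/\ forall i, 0 <= l i, \sum_i l i = 1 &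
        x = \sum_i l i *: tnth (in_tuple s) i]].

Definition domain (Omega : set (R * R)) : Prop :=
  [/\ Omega !=set0, open Omega & connected Omega].

(* A triangle is given by its vertices, and stands for the closed set conv t. *)
Definition nondegenerate (t : 3.-tuple (R * R)) : Prop :=
  let a := tnth t ord0 in let b := tnth t (inord 1) in
  let c := tnth t (inord 2) in dot (perp (b - a)) (c - a) != 0.

(* Conforming triangulation: two triangles meet exactly in the simplex (empty
   set, vertex, edge or whole triangle) spanned by their common vertices. *)
Definition triangulation (D : set (R * R)) (T : seq (3.-tuple (R * R))) : Prop :=
  [/\ forall t, t \in T -> nondegenerate t,
      \bigcup_(t in [set` T]) conv t = D &
      forall t t', t \in T -> t' \in T ->
        conv t `&` conv t' = conv [seq p <- t | p \in (t' : seq _)]].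

End Plane.

Section Bulk.
Context {R : realType}.
Variables (Omega : set (R * R)) (T : seq (3.-tuple (R * R))).

(* Functions on the closure of Omega are represented by functions on the plane
   whose values elsewhere are irrelevant. *)
Definition affine_on (o : set (R * R)) (v : R * R -> R) : Prop :=
  exists (a : R * R) (c : R), forall x, o x -> v x = dot a x + c.

Definition inS (v : R * R -> R) : Prop :=
  {within closure Omega, continuous v} /\
  forall t, t \in T -> affine_on (conv t) v.

Definition inSSigma (phi : 'I_3 -> R * R -> R) : Prop :=
  (forall j, inS (phi j)) /\
  forall x, closure Omega x -> \sum_j phi j x = 0.

(* The gradient of an element of S^m exists off the edges of the
   triangulation, which form a null set. *)
Definition grad (v : R * R -> R) (x : R * R) : R * R :=
  ('D_((1, 0) : R * R) v x, 'D_((0, 1) : R * R) v x).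

Definition leb2 := (@lebesgue_measure R \x @lebesgue_measure R)%E.

Definition ip_grad (V W : 'I_3 -> R * R -> R) : R :=
  \sum_j \int[leb2]_(x in Omega) dot (grad (V j) x) (grad (W j) x).

End Bulk.

Section Curves.
Context {R : realType}.

Definition mesh (N : nat) (q : nat -> R) : Prop :=
  [/\ (2 <= N)%N, q 0%N = 0, q N = 1 &
      forall j, (j < N)%N -> q j < q j.+1].

(* Functions on I = [0, 1] are represented by functions on R whose values
   outside I are irrelevant. *)
Definition inVh (N : nat) (q : nat -> R) (f : R -> R) : Prop :=
  {within `[0, 1], continuous f} /\
  forall j, (j < N)%N -> exists a b : R,
    forall x, q j <= x <= q j.+1 -> f x = a * x + b.

Definition inVh2 (N : nat) (q : nat -> R) (f : R -> R * R) : Prop :=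
  inVh N q (fst \o f) /\ inVh N q (snd \o f).

(* Nodal interpolation: the j-th summand is constant off [q j, q j.+1] and
   rises linearly by f (q j.+1) - f (q j) on that interval. *)
Definition interp (N : nat) (q : nat -> R) (f : R -> R) (x : R) : R :=
  f (q 0%N) + \sum_(j < N) (f (q j.+1) - f (q j)) *
    Num.max 0 (Num.min 1 ((x - q j) / (q j.+1 - q j))).

Definition inV (N : 'I_3 -> nat) (q : 'I_3 -> nat -> R)
    (f : 'I_3 -> R -> R) : Prop :=
  forall i, inVh (N i) (q i) (f i).

Definition inVvec (N : 'I_3 -> nat) (q : 'I_3 -> nat -> R)
    (X : 'I_3 -> R -> R * R) : Prop :=
  (forall i, inVh2 (N i) (q i) (X i)) /\
  (forall i i', X i 0 = X i' 0 /\ X i 1 = X i' 1).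

Section OneCurve.
Variables (N : nat) (q : nat -> R) (X : R -> R * R).

Definition edge (j : nat) : R * R := X (q j.+1) - X (q j).

Definition curve_length : R := \sum_(j < N) enorm (edge j).

(* On each edge this is the constant unit normal; the value at the
   nodes is a convention and does not affect integrals. *)
Definition normal (rho : R) : R * R :=
  \sum_(j < N | q j <= rho < q j.+1) (enorm (edge j))^-1 *: perp (edge j).

(* Integral over the curve, and its mass-lumped version, of w given on I. *)
Definition curve_int (w : R -> R) : R :=
  \int[lebesgue_measure]_(rho in `[0, 1]) (w rho * enorm (derive1 X rho)).

Definition curve_int_h (w : R -> R) : R :=
  2^-1 * \sum_(j < N) enorm (edge j) *
    (lim (w @ (q j.+1)^'-) + lim (w @ (q j)^'+)).

Definition ip (u v : R -> R) : R := curve_int (fun rho => u rho * v rho).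

Definition ip_h (u v : R -> R) : R := curve_int_h (fun rho => u rho * v rho).

(* The two readings of the superscript (h). *)
Definition ip_opt (lumped : bool) : (R -> R) -> (R -> R) -> R :=
  if lumped then ip_h else ip.

Definition ip_vec (u v : R -> R * R) : R :=
  curve_int (fun rho => dot (u rho) (v rho)).

Definition ip_vec_h (u v : R -> R * R) : R :=
  curve_int_h (fun rho => dot (u rho) (v rho)).

Definition ip_grads (Y eta : R -> R * R) : R :=
  \int[lebesgue_measure]_(rho in `[0, 1])
    (dot (derive1 Y rho) (derive1 eta rho) * (enorm (derive1 X rho))^-1).

Definition vertex_normal (omega : R -> R * R) : Prop :=
  inVh2 N q omega /\
  forall xi, inVh2 N q xi -> ip_vec_h omega xi = ip_vec normal xi.

End OneCurve.

Definition ph1 : 'I_3 := @Ordinal 3 0 isT.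
Definition ph2 : 'I_3 := @Ordinal 3 1 isT.
Definition ph3 : 'I_3 := @Ordinal 3 2 isT.

Definition Lambda : seq ('I_3 * 'I_3 * 'I_3) :=
  [:: (ph1, ph3, ph2); (ph2, ph1, ph3); (ph3, ph2, ph1)].

Definition weighted_length (N : 'I_3 -> nat) (q : 'I_3 -> nat -> R)
    (sigma : 'I_3 -> R) (X : 'I_3 -> R -> R * R) : R :=
  \sum_i sigma i * curve_length (N i) (q i) (X i).

End Curves.

(* Main.v *)
Require Import Defs.
From HB Require Import structures.
From mathcomp Require Import all_boot all_order all_algebra.
From mathcomp Require Import ring lra.
From mathcomp Require Import all_classical all_reals all_analysis.
From mathcomp Require Import measurable_realfun.

Set Implicit Arguments.
Unset Strict Implicit.
Unset Printing Implicit Defensive.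

Import Order.TTheory GRing.Theory Num.Theory numFieldNormedType.Exports.
Local Open Scope classical_set_scope.
Local Open Scope ring_scope.

(** Write [X], [X'] for the curves at the old and the new time level and
[eta = X' - X].  The scheme is tested with the new potential [W'], with the
nodal interpolant [xi] of [eta . omega / tau], and with [eta] itself.

The first two equations then contain the same coupling term between bulk and
curves, once with [xi] paired against [W'_j - W'_k] and once the other way
round, so that the squared norm of the gradient of [W'] equals the sum of the
lumped products of [kappa'] with [xi].  It does not matter which quadrature is
used in the coupling term, provided that it is symmetric ([ip_optC]).  Mass
lumping only sees values at the mesh nodes, where interpolation changes nothing;
hence this lumped product is also [1 / tau] times that of [kappa' omega] with
[eta] ([ip_h_interp_dot]), which the third equation identifies with minus the
weighted sum of [ip_grads X X' eta].  Thus [tau] times the dissipation equals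
minus that sum.

It remains to see that [ip_grads X X' (X' - X)] is at least the increase of
length ([curve_length_le]).  All derivatives are constant on mesh cells, so the
integral is the sum over the edges [e] of [X] and [e'] of [X'] of
[e' . (e' - e) / |e|] ([ip_grads_edge]), and each term is at least [|e'| - |e|]
by Cauchy-Schwarz and [(|e'| - |e|)^2 >= 0] ([enormB_le]). *)

(** * Nodal values of piecewise affine functions *)

Section Mesh.
Context {R : realType}.
Implicit Types (N : nat) (q : nat -> R) (f u v : R -> R) (X Y : R -> R * R).

Lemma mesh_le N q i j : mesh N q -> (i <= j <= N)%N -> q i <= q j.
Proof.
move=> [_ _ _ q_lt]; elim: j => [|j IHj] /andP[ij jN].
  by move: ij; rewrite leqn0 => /eqP ->.
move: ij; rewrite leq_eqVlt => /predU1P[->//|ij].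
by rewrite (le_trans (IHj _)) ?(ltW (q_lt _ _))// -ltnS ij ltnW.
Qed.

Lemma mesh_edge_sub N q j : mesh N q -> (j < N)%N ->
  `[q j, q j.+1] `<=` `[0, 1].
Proof.
move=> qN jN; have [_ q0 q1 _] := qN; apply: subset_itv; rewrite bnd_simp.
- by rewrite -q0 (mesh_le qN)//= ltnW.
- by rewrite -q1 (mesh_le qN)// jN /=.
Qed.

Lemma within_continuousM (A : set R) u v :
  {within A, continuous u} -> {within A, continuous v} ->
  {within A, continuous (fun x => u x * v x)}.
Proof. by move=> cu cv x; apply: cvgM; [exact: cu|exact: cv]. Qed.

(** Mass lumping uses one-sided limits to allow for functions that jump at the
nodes; for a continuous integrand it is the trapezoidal rule. *)
Lemma curve_int_h_nodal N q X f : mesh N q ->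
  {within `[0, 1], continuous f} ->
  curve_int_h N q X f =
  2^-1 * \sum_(j < N) enorm (edge q X j) * (f (q j.+1) + f (q j)).
Proof.
move=> qN cf; congr (_ * _); apply: eq_bigr => j _.
have [_ _ _ q_lt] := qN.
have := continuous_subspaceW (mesh_edge_sub qN (ltn_ord j)) cf.
move/(continuous_within_itvP _ (q_lt _ (ltn_ord j))) => [_ fr fl].
by rewrite (cvg_lim _ fr)// (cvg_lim _ fl).
Qed.

Lemma clamp_eq0 (t : R) : t <= 0 -> Num.max 0 (Num.min 1 t) = 0.
Proof. by move=> t0; rewrite min_r ?max_l// (le_trans t0). Qed.

Lemma clamp_eq1 (t : R) : 1 <= t -> Num.max 0 (Num.min 1 t) = 1.
Proof. by move=> t1; rewrite min_l// max_r. Qed.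

Lemma clamp_id (t : R) : 0 <= t <= 1 -> Num.max 0 (Num.min 1 t) = t.
Proof. by move=> /andP[t0 t1]; rewrite min_r// max_r. Qed.

(** For [x] in the [j]-th cell, the clamped coordinate of every earlier cell
equals 1 and that of every later cell equals 0, so the earlier increments
telescope to [f (q j) - f (q 0)] and the later ones vanish. *)
Lemma interp_edge N q f j x : mesh N q -> (j < N)%N -> q j <= x <= q j.+1 ->
  interp N q f x =
  f (q j) + (f (q j.+1) - f (q j)) * ((x - q j) / (q j.+1 - q j)).
Proof.
move=> qN jN /andP[jx xj]; have [_ _ _ q_lt] := qN.
have h_gt0 i : (i < N)%N -> 0 < q i.+1 - q i by move=> /q_lt; rewrite subr_gt0.
pose F i := (f (q i.+1) - f (q i)) *
  Num.max 0 (Num.min 1 ((x - q i) / (q i.+1 - q i))).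
rewrite /interp -(big_mkord xpredT F) (big_cat_nat _ (n := j)) ?(ltnW jN)//=.
rewrite (big_ltn jN).
have -> : \sum_(0 <= i < j) F i = f (q j) - f (q 0%N).
  rewrite -(telescope_sumr (f \o q))//; apply: eq_big_nat => i /andP[_ ij].
  rewrite /F clamp_eq1 ?mulr1// ler_pdivlMr ?h_gt0 ?(ltn_trans ij)// mul1r.
  by rewrite lerD2r (le_trans _ jx)// (mesh_le qN)// ij ltnW.
have -> : \sum_(j.+1 <= i < N) F i = 0.
  rewrite big_nat big1// => i /andP[ji iN].
  rewrite /F clamp_eq0 ?mulr0// pmulr_lle0 ?invr_gt0 ?h_gt0// subr_le0.
  by rewrite (le_trans xj)// (mesh_le qN)// ji ltnW.
rewrite /F clamp_id; first by rewrite addr0 addrA subrKC.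
rewrite divr_ge0 ?subr_ge0 ?(ltW (q_lt _ _))//=.
by rewrite ler_pdivrMr ?h_gt0// mul1r lerD2r.
Qed.

Lemma interp_nodel N q f j : mesh N q -> (j < N)%N ->
  interp N q f (q j) = f (q j).
Proof.
move=> qN jN; have [_ _ _ q_lt] := qN.
rewrite (interp_edge f qN jN) ?lexx ?(ltW (q_lt _ _))//.
by rewrite subrr mul0r mulr0 addr0.
Qed.

Lemma interp_noder N q f j : mesh N q -> (j < N)%N ->
  interp N q f (q j.+1) = f (q j.+1).
Proof.
move=> qN jN; have [_ _ _ q_lt] := qN.
rewrite (interp_edge f qN jN) ?lexx ?(ltW (q_lt _ _))// divff ?mulr1 ?subrKC//.
by rewrite gt_eqF// subr_gt0 q_lt.
Qed.

Lemma interp_continuous N q f : continuous (interp N q f).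
Proof.
move=> x; apply: cvgD; first exact: cvg_cst.
apply: cvg_big; first exact: add_continuous.
move=> j _; apply: cvgM; first exact: cvg_cst.
pose t y := (y - q j) / (q j.+1 - q j).
apply: (@continuous_max R R (fun=> 0) (fun y => Num.min 1 (t y))).
  exact: cvg_cst.
apply: (@continuous_min R R (fun=> 1) t); first exact: cvg_cst.
by apply: cvgM; [apply: cvgB; [exact: cvg_id|exact: cvg_cst]|exact: cvg_cst].
Qed.

Lemma interp_inVh N q f : mesh N q -> inVh N q (interp N q f).
Proof.
move=> qN; split; first exact/continuous_subspaceT/interp_continuous.
move=> j jN; set s := (f (q j.+1) - f (q j)) / (q j.+1 - q j).
exists s, (f (q j) - s * q j) => x xj.
by rewrite (interp_edge f qN jN xj) /s; ring.
Qed.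

Lemma inVhB N q u v :
  inVh N q u -> inVh N q v -> inVh N q (fun x => u x - v x).
Proof.
move=> [cu au] [cv av]; split; first exact: within_continuousB cu cv.
move=> j jN; have [a [b uE]] := au _ jN; have [c [d vE]] := av _ jN.
by exists (a - c), (b - d) => x xj; rewrite uE// vE//; ring.
Qed.

Lemma inVh2B N q X Y :
  inVh2 N q X -> inVh2 N q Y -> inVh2 N q (fun x => X x - Y x).
Proof.
by move=> [X1 X2] [Y1 Y2]; split; [exact: inVhB X1 Y1|exact: inVhB X2 Y2].
Qed.

Lemma inVh_edge N q f j x : mesh N q -> inVh N q f -> (j < N)%N ->
  q j <= x <= q j.+1 ->
  f x = f (q j) + (x - q j) / (q j.+1 - q j) * (f (q j.+1) - f (q j)).
Proof.
move=> [_ _ _ q_lt] [_ /(_ j) af] jN xj; have [a [b fE]] := af jN.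
rewrite !fE ?lexx ?(ltW (q_lt _ _))//.
by field; rewrite gt_eqF// subr_gt0 q_lt.
Qed.

Lemma inVh2_edge N q X j x : mesh N q -> inVh2 N q X -> (j < N)%N ->
  q j <= x <= q j.+1 ->
  X x = X (q j) + ((x - q j) / (q j.+1 - q j)) *: edge q X j.
Proof.
move=> qN [X1 X2] jN xj; apply/pair_eqP/andP; split; apply/eqP.
- exact: (inVh_edge qN X1 jN xj).
- exact: (inVh_edge qN X2 jN xj).
Qed.

(** The difference quotient is constant near 0, which makes the derivative
computable at interior points of a cell; at the nodes [X] need not be
differentiable. *)
Lemma derive1_edge N q X j x : mesh N q -> inVh2 N q X -> (j < N)%N ->
  q j < x < q j.+1 -> derive1 X x = (q j.+1 - q j)^-1 *: edge q X j.
Proof.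
move=> qN XV jN xj; apply: lim_near_cst; first exact: norm_hausdorff.
have /nbhs0P xj_near : \forall y \near x, q j < y < q j.+1.
  have /near_in_itvoo : x \in `]q j, q j.+1[ by rewrite in_itv.
  by apply: filterS => y; rewrite in_itv.
have h_neq0 : \forall h \near (0 : R)^', h != 0 by exact: nbhs_dnbhs_neq.
near=> h.
have h0 : h != 0 by near: h.
have hxj : q j < h + x < q j.+1.
  by rewrite addrC; near: h; exact: (nbhs_dnbhs xj_near).
move: xj hxj => /andP[/ltW jx /ltW xj] /andP[/ltW jhx /ltW hxj].
rewrite (inVh2_edge qN XV jN (x := h + x)) ?jhx//.
rewrite (inVh2_edge qN XV jN (x := x)) ?jx//.
rewrite opprD addrACA subrr add0r -scalerBl scalerA; congr (_ *: _).
by rewrite -mulrBl mulrA -[RHS]mul1r; congr (_ * _); field.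
Unshelve. all: by end_near. Qed.

End Mesh.

(** * Integrals of step functions *)

Section Step.
Context {R : realType}.
Implicit Types (N : nat) (q : nat -> R) (g : R -> R) (c : nat -> R).

(** Half-open cells are used because they concatenate without overlap; the
unknown value of [g] at [a] affects neither measurability nor the integral. *)
Lemma integral_step_cell (g : R -> R) (a b c : R) : a < b ->
  (forall x, a < x < b -> g x = c) ->
  measurable_fun `[a, b[ g /\
  (\int[lebesgue_measure]_(x in `[a, b[) (g x)%:E = (c * (b - a))%:E)%E.
Proof.
move=> ab gc.
have mg : measurable_fun `]a, b[ g.
  apply: (eq_measurable_fun (cst c)); last exact: measurable_cst.
  by move=> x; rewrite inE /= in_itv => /gc ->.
split; first exact/measurable_fun_itv_obnd_cbndP.
rewrite (eq_integral_itv_bounded (g := cst c))//.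
rewrite (integral_cst lebesgue_measure _ c%:E)//= lebesgue_measure_itv/=.
by rewrite lte_fin ab -EFinB -EFinM.
Qed.

Lemma integral_step N q g c : (forall j, (j < N)%N -> q j < q j.+1) ->
  (forall j x, (j < N)%N -> q j < x < q j.+1 -> g x = c j) ->
  measurable_fun `[q 0%N, q N[ g /\
  (\int[lebesgue_measure]_(x in `[q 0%N, q N[) (g x)%:E =
    (\sum_(j < N) c j * (q j.+1 - q j))%:E)%E.
Proof.
elim: N => [|N IHN] q_lt gc.
  rewrite set_itvco0 integral_set0 big_ord0; split=> //.
  exact: measurable_fun_set0.
have [mg intg] := IHN (fun j jN => q_lt j (ltnW jN))
                      (fun j x jN => gc j x (ltnW jN)).
have [mgN intgN] :=
  integral_step_cell (q_lt N (ltnSn N)) (fun x => gc N x (ltnSn N)).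
have q0N : q 0%N <= q N.
  elim: N q_lt {IHN gc mg intg mgN intgN} => // N IHN q_lt.
  rewrite (le_trans (IHN _)) ?(ltW (q_lt _ _))// => j jN.
  by rewrite q_lt// ltnW.
have splitE : `[q 0%N, q N.+1[%classic = `[q 0%N, q N[ `|` `[q N, q N.+1[.
  by rewrite -itv_bndbnd_setU// bnd_simp// ltW// q_lt.
have mgU : measurable_fun `[q 0%N, q N.+1[ g.
  by rewrite splitE; apply/measurable_funU.
split => //; rewrite {1}splitE integral_setU//.
- by rewrite intg intgN big_ord_recr.
- by rewrite -splitE; exact/measurable_EFinP.
- apply/disj_setPS => x [] /=; rewrite !in_itv/= => /andP[_ xN] /andP[Nx _].
  by move: xN; rewrite ltNge Nx.
Qed.

Lemma Rintegral_step N q g c : mesh N q ->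
  (forall j x, (j < N)%N -> q j < x < q j.+1 -> g x = c j) ->
  \int[lebesgue_measure]_(x in `[0, 1]) g x =
  \sum_(j < N) c j * (q j.+1 - q j).
Proof.
move=> [_ q0 q1 q_lt] gc; have [+ intg] := integral_step q_lt gc.
rewrite q0 q1 in intg *; move=> mg.
rewrite /Rintegral -integral_itv_bndo_bndc; last exact/measurable_EFinP.
by rewrite intg.
Qed.

End Step.

(** * Discrete energy estimate *)

Section Energy.
Context {R : realType}.
Implicit Types (N : nat) (q : nat -> R) (u v : R * R) (X Y : R -> R * R).

Lemma dotZZ (a b : R) u v : dot (a *: u) (b *: v) = a * b * dot u v.
Proof. by rewrite /dot /=/GRing.scale/=; ring. Qed.

Lemma dot_ge0 u : 0 <= dot u u.
Proof. by rewrite /dot -!expr2 addr_ge0 ?sqr_ge0. Qed.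

Lemma enorm_ge0 u : 0 <= enorm u.
Proof. exact: sqrtr_ge0. Qed.

Lemma enorm_sqr u : enorm u ^+ 2 = dot u u.
Proof. by rewrite sqr_sqrtr// dot_ge0. Qed.

Lemma enormZ (a : R) u : 0 <= a -> enorm (a *: u) = a * enorm u.
Proof.
by move=> a0; rewrite /enorm dotZZ -expr2 sqrtrM ?sqr_ge0// sqrtr_sqr ger0_norm.
Qed.

Lemma dot_le_enorm u v : dot u v <= enorm u * enorm v.
Proof.
rewrite (le_trans (ler_norm _))// -ler_sqr ?nnegrE ?mulr_ge0 ?enorm_ge0//.
rewrite real_normK ?num_real// exprMn !enorm_sqr -subr_ge0.
suff -> : dot u u * dot v v - dot u v ^+ 2 = (u.1 * v.2 - u.2 * v.1) ^+ 2.
  exact: sqr_ge0.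
by rewrite /dot; ring.
Qed.

(** Multiplying by [enorm v], the claim becomes
[|u| |v| - |v|^2 <= |u|^2 - u . v]. Cauchy-Schwarz bounds the right side below
by [|u|^2 - |u| |v|], and the difference is then [(|u| - |v|)^2]. *)
Lemma enormB_le u v : 0 < enorm v ->
  enorm u - enorm v <= dot u (u - v) / enorm v.
Proof.
move=> v0; rewrite ler_pdivlMr//.
have -> : dot u (u - v) = enorm u ^+ 2 - dot u v.
  by rewrite enorm_sqr /dot/=; ring.
have := dot_le_enorm u v; have := sqr_ge0 (enorm u - enorm v).
by rewrite !expr2; nra.
Qed.

(** On a cell of width [h] the two derivatives contribute a factor [h^-2] and the
inverse of the length element a factor [h]; integrating over the cell cancels
the remaining [h^-1], so the mesh widths disappear. *)
Lemma ip_grads_edge N q X Y Z : mesh N q ->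
  inVh2 N q X -> inVh2 N q Y -> inVh2 N q Z ->
  (forall j, (j < N)%N -> 0 < enorm (edge q X j)) ->
  ip_grads X Y Z =
  \sum_(j < N) dot (edge q Y j) (edge q Z j) / enorm (edge q X j).
Proof.
move=> qN XV YV ZV X_edges; have [_ _ _ q_lt] := qN.
rewrite /ip_grads (Rintegral_step (N := N) (q := q) (c := fun j =>
  (q j.+1 - q j)^-1 * (dot (edge q Y j) (edge q Z j) / enorm (edge q X j)))) //.
  apply: eq_bigr => j _.
  by rewrite mulrAC mulVf ?mul1r// gt_eqF// subr_gt0 q_lt.
move=> j x jN xj; rewrite !(derive1_edge qN _ jN xj)// dotZZ enormZ; last first.
  by rewrite invr_ge0 subr_ge0 ltW// q_lt.
field; rewrite !gt_eqF ?X_edges// subr_gt0.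
exact: q_lt.
Qed.

(** This is what makes the time stepping unconditionally stable: the length
element is that of the old curve [X] while the derivative tested is that of the
new curve [Y], so that [enormB_le] applies on every edge. *)
Lemma curve_length_le N q X Y : mesh N q -> inVh2 N q X -> inVh2 N q Y ->
  (forall j, (j < N)%N -> 0 < enorm (edge q X j)) ->
  curve_length N q Y - curve_length N q X <=
  ip_grads X Y (fun rho => Y rho - X rho).
Proof.
move=> qN XV YV X_edges; rewrite (ip_grads_edge qN)//; last exact: inVh2B.
rewrite /curve_length -sumrB; apply: ler_sum => j _.
have -> : edge q (fun rho => Y rho - X rho) j = edge q Y j - edge q X j.
  by rewrite /edge opprB addrACA [X in _ + X]addrC opprB addrACA.
exact/enormB_le/X_edges.
Qed.

Lemma ip_optC (lumped : bool) N q X (u v : R -> R) :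
  ip_opt N q X lumped u v = ip_opt N q X lumped v u.
Proof.
have uvC : (fun rho => u rho * v rho) = (fun rho => v rho * u rho).
  by apply/funext => rho; rewrite mulrC.
by case: lumped; rewrite /= /ip_h /ip uvC.
Qed.

(** Both sides are lumped products of continuous integrands that agree at the
nodes, although between the nodes [interp] differs from its argument, which is
quadratic on each cell. *)
Lemma ip_h_interp_dot N q X (k : R -> R) (omega eta : R -> R * R) (a : R) :
  mesh N q -> inVh N q k -> inVh2 N q omega -> inVh2 N q eta ->
  ip_h N q X k (interp N q (fun rho => dot (a *: eta rho) (omega rho))) =
  a * ip_vec_h N q X (fun rho => k rho *: omega rho) eta.
Proof.
move=> qN [ck _] [[co1 _] [co2 _]] [[ce1 _] [ce2 _]].
rewrite /ip_h /ip_vec_h !curve_int_h_nodal//.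
- rewrite mulrCA; congr (_ * _); rewrite mulr_sumr; apply: eq_bigr => j _.
  rewrite (interp_nodel _ qN (ltn_ord j)) (interp_noder _ qN (ltn_ord j)).
  rewrite /dot /= /GRing.scale/=; ring.
- apply: (@within_continuousD _ _ _ _
    (fun x => k x * (omega x).1 * (eta x).1)
    (fun x => k x * (omega x).2 * (eta x).2)).
  + by apply: within_continuousM => //; exact: within_continuousM.
  + by apply: within_continuousM => //; exact: within_continuousM.
- apply: within_continuousM => //.
  exact/continuous_subspaceT/interp_continuous.
Qed.

End Energy.

Theorem theorem4p3 (R : realType)
  (Omega : set (R * R))
  (Omega_domain : domain Omega)
  (Omega_bounded : bounded_set Omega)
  (T : nat -> seq (3.-tuple (R * R)))
  (tau : nat -> R)
  (sigma : 'I_3 -> R)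
  (sigma_gt0 : forall i, 0 < sigma i)
  (sigma1_le : sigma ph1 <= sigma ph2 + sigma ph3)
  (sigma2_le : sigma ph2 <= sigma ph1 + sigma ph3)
  (sigma3_le : sigma ph3 <= sigma ph1 + sigma ph2)
  (N : 'I_3 -> nat) (q : 'I_3 -> nat -> R)
  (Nq_mesh : forall i, mesh (N i) (q i))
  (W : nat -> 'I_3 -> R * R -> R)
  (X : nat -> 'I_3 -> R -> R * R)
  (kappa : nat -> 'I_3 -> R -> R)
  (omega : nat -> 'I_3 -> R -> R * R)
  (m : nat)
  (T_triangulation : triangulation (closure Omega) (T m))
  (tau_gt0 : 0 < tau m)
  (X_in : inVvec N q (X m))
  (kappa_in : inV N q (kappa m))
  (X_Omega : forall i rho, 0 <= rho <= 1 -> Omega (X m i rho))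
  (X_edges : forall i j, (j < N i)%N -> 0 < enorm (edge (q i) (X m i) j))
  (omega_normal : forall i, vertex_normal (N i) (q i) (X m i) (omega m i))
  (lumped : bool)
  (W'_in : inSSigma Omega (T m) (W m.+1))
  (X'_in : inVvec N q (X m.+1))
  (kappa'_in : inV N q (kappa m.+1))
  (eq_W : forall phi, inSSigma Omega (T m) phi ->
    ip_grad Omega (W m.+1) phi -
    \sum_(l <- Lambda) (let: (i, j, k) := l in
      ip_opt (N i) (q i) (X m i) lumped
        (interp (N i) (q i) (fun rho =>
           dot ((tau m)^-1 *: (X m.+1 i rho - X m i rho)) (omega m i rho)))
        (fun rho => phi j (X m i rho) - phi k (X m i rho))) = 0)
  (eq_kappa : forall xi, inV N q xi ->
    \sum_i ip_h (N i) (q i) (X m i) (kappa m.+1 i) (xi i) -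
    \sum_(l <- Lambda) (let: (i, j, k) := l in
      ip_opt (N i) (q i) (X m i) lumped
        (fun rho => W m.+1 j (X m i rho) - W m.+1 k (X m i rho))
        (xi i)) = 0)
  (eq_X : forall eta, inVvec N q eta ->
    \sum_i ip_vec_h (N i) (q i) (X m i)
      (fun rho => kappa m.+1 i rho *: omega m i rho) (eta i) +
    \sum_i sigma i * ip_grads (X m i) (X m.+1 i) (eta i) = 0) :
  weighted_length N q sigma (X m.+1) +
    tau m * ip_grad Omega (W m.+1) (W m.+1)
  <= weighted_length N q sigma (X m).
Proof.
have [X_V X_bd] := X_in; have [X'_V X'_bd] := X'_in.
pose eta i rho := X m.+1 i rho - X m i rho.
have eta_V i : inVh2 (N i) (q i) (eta i) by exact: inVh2B.
have eta_in : inVvec N q eta.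
  split=> // i i'; have [X0 X1] := X_bd i i'; have [X'0 X'1] := X'_bd i i'.
  by rewrite /eta X0 X1 X'0 X'1.
pose xi i := interp (N i) (q i) (fun rho =>
  dot ((tau m)^-1 *: eta i rho) (omega m i rho)).
have xi_in : inV N q xi by move=> i; exact: interp_inVh.
have /eqP := eq_W _ W'_in; rewrite subr_eq0 => /eqP energyE.
have /eqP := eq_kappa _ xi_in; rewrite subr_eq0 => /eqP kappaE.
have /eqP := eq_X _ eta_in; rewrite addr_eq0 => /eqP XE.
have dissipation : tau m * ip_grad Omega (W m.+1) (W m.+1) =
    - \sum_i sigma i * ip_grads (X m i) (X m.+1 i) (eta i).
  have -> : ip_grad Omega (W m.+1) (W m.+1) =
      \sum_i ip_h (N i) (q i) (X m i) (kappa m.+1 i) (xi i).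
    by rewrite kappaE energyE; apply: eq_bigr => -[[i j] k] _; exact: ip_optC.
  rewrite -XE mulr_sumr; apply: eq_bigr => i _.
  rewrite ip_h_interp_dot//; first by rewrite mulrA divff ?mul1r// gt_eqF.
  by case: (omega_normal i).
rewrite dissipation -lerBrDr opprK -lerBlDl /weighted_length -sumrB.
apply: ler_sum => i _; rewrite -mulrBr ler_wpM2l ?(ltW (sigma_gt0 _))//.
by apply: curve_length_le => //; exact: X_edges.
Qed.
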